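(* Let $\phi=(\phi_1,\dots,\phi_N): I^N\to\mathbb R^N$ be a continuous map, where $I^N=[0,1]^N$, such that for every $j\in\{1,\dots,N\}$ at least one of the following conditions holds: (C) $\phi_j([x_j=0]\cup[x_j=1])\subseteq[0,1]$; (E) for every continuous path $\gamma=(\gamma_1,\dots,\gamma_N):[0,1]\to I^N$ such that $\gamma_j(0)=0$ and $\gamma_j(1)=1$, it holds that $\phi_j(\gamma([0,1]))\supseteq[0,1]$. Then $\phi$ has at least one fixed point in $I^N$.
   Context: $[x_j=k]$ denotes the set $\{x=(x_1,\dots,x_N)\in I^N: x_j=k\}$. *)

(* Defs.v *)
From HB Require Import structures.
From mathcomp Require Import all_boot all_order all_algebra.
From mathcomp Require Import all_classical all_reals all_analysis.

Set Implicit Arguments.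
Unset Strict Implicit.
Unset Printing Implicit Defensive.

Import Order.TTheory GRing.Theory Num.Theory.
Import numFieldNormedType.Exports.

Local Open Scope classical_set_scope.
Local Open Scope ring_scope.

Section Cube.
Context {R : realType}.

Definition unit_cube (N : nat) : set 'rV[R]_N :=
  [set x : 'rV[R]_N | forall i : 'I_N, x ord0 i \in `[0, 1]].

(* [x_j = k] *)
Definition cube_slice (N : nat) (j : 'I_N) (k : R) : set 'rV[R]_N :=
  [set x : 'rV[R]_N | unit_cube x /\ x ord0 j = k].

(* A map with domain D is a total function of which only the values on D
   matter; its continuity is continuity for the subspace topology of D. *)
Definition cube_path (N : nat) (gamma : R -> 'rV[R]_N) : Prop :=
  {within `[0, 1], continuous gamma} /\
  (forall t : R, t \in `[0, 1] -> unit_cube (gamma t)).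

Definition condC (N : nat) (phi : 'rV[R]_N -> 'rV[R]_N) (j : 'I_N) : Prop :=
  (fun x => phi x ord0 j) @` (cube_slice j 0 `|` cube_slice j 1)
    `<=` `[0, 1].

Definition condE (N : nat) (phi : 'rV[R]_N -> 'rV[R]_N) (j : 'I_N) : Prop :=
  forall gamma : R -> 'rV[R]_N, cube_path gamma ->
    gamma 0 ord0 j = 0 -> gamma 1 ord0 j = 1 ->
    `[0, 1] `<=` (fun x => phi x ord0 j) @` (gamma @` `[0, 1]).

End Cube.

(* Main.v *)
Require Import Defs.
From HB Require Import structures.
From mathcomp Require Import all_boot all_order all_algebra.
From mathcomp Require Import fingroup perm lra.
From mathcomp Require Import all_classical all_reals all_analysis.

(* Put f_j x = phi_j x - x_j.  By the intermediate value theorem, (C) and (E)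
   both imply that every path in the cube from [x_j = 0] to [x_j = 1] meets a
   zero of f_j.  If phi has no fixed point, then by compactness there is a
   mesh 1/n such that on each small grid cube some f_j has no zero.  Label a
   grid vertex u, for each j, by 0 if u_j = 0 or if u is joined to [x_j = 0]
   by a path in the cube avoiding the zeros of f_j, and by 1 otherwise.  All
   vertices of [x_j = 1] get 1, so a cubical Sperner lemma gives a small cube
   on which every one of the N labels takes both values; but if f_j has no zero
   on that cube, joining vertices by segments shows that its j-th label is
   constant there.

   The cubical Sperner lemma is proved by cohomology mod 2: the cup product
   da_1 ... da_N of the coboundaries of the labels a_k, summed over the
   simplices of the Kuhn triangulation of the grid, depends only on the boundary
   behaviour of the labels (discrete Stokes formula), hence equals its value 1
   for the labels [0 < u_k]. *)

Import Order.TTheory GRing.Theory Num.Theory.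
Import numFieldNormedType.Exports.

Local Open Scope classical_set_scope.
Local Open Scope ring_scope.

(** * The Leibniz rule for cup products *)

Lemma bump_geq {h k} : (h <= k)%N -> bump h k = k.+1.
Proof. by rewrite /bump => ->. Qed.

Lemma bump_ltn {h k} : (k < h)%N -> bump h k = k.
Proof. by move=> lt_kh; rewrite /bump leqNgt lt_kh. Qed.

Section Leibniz.
Context {R : comNzRingType} (addRR : forall x : R, x + x = 0).
Implicit Types x : nat -> nat -> R.

(** As d d = 0, the coboundary of dx_0 ... dx_(i-1) vanishes on the simplex 0, ..., i+1. In
    characteristic 2 the faces omitting some m <= i thus add up to the face omitting i+1. *)
Lemma leibniz_left x (i : nat) :
  \sum_(0 <= m < i.+1) \prod_(0 <= k < i)
     (x k (bump m k.+1) + x k (bump m k)) =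
  \prod_(0 <= k < i) (x k k.+1 + x k k).
Proof.
elim: i => [|i IHi]; first by rewrite big_nat1 !big_geq.
rewrite big_nat_recr //= [RHS]big_nat_recr //=.
have -> : \sum_(0 <= m < i.+1) \prod_(0 <= k < i.+1)
     (x k (bump m k.+1) + x k (bump m k)) =
   (\prod_(0 <= k < i) (x k k.+1 + x k k)) * (x i i.+2 + x i i.+1).
  rewrite -IHi mulr_suml; apply: eq_big_nat => m.
  rewrite ltnS => /andP[_ le_mi].
  by rewrite big_nat_recr //= (bump_geq le_mi) (bump_geq (leqW le_mi)).
have -> : \prod_(0 <= k < i.+1) (x k (bump i.+1 k.+1) + x k (bump i.+1 k)) =
   (\prod_(0 <= k < i) (x k k.+1 + x k k)) * (x i i.+2 + x i i).
  rewrite big_nat_recr //= (bump_geq (leqnn _)) (bump_ltn (ltnSn _)).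
  congr (_ * _); apply: eq_big_nat => k /andP[_ lt_ki].
  by rewrite !bump_ltn // ltnS ltnW.
by rewrite -mulrDr addrACA addRR add0r [x i i.+1 + _]addrC.
Qed.

(** Mirror image, on the simplex i, ..., i+d+1: the faces omitting some m > i add up to the face
    omitting i. *)
Lemma leibniz_right x (i d : nat) :
  \sum_(i.+1 <= m < (i + d).+2) \prod_(i.+1 <= k < (i + d).+1)
     (x k (bump m k) + x k (bump m k.-1)) =
  \prod_(i.+1 <= k < (i + d).+1) (x k k.+1 + x k k).
Proof.
elim: d i => [|d IHd] i; first by rewrite addn0 big_nat1 !big_geq.
have lt_i : (i.+1 < (i.+1 + d).+1)%N by rewrite ltnS leq_addr.
rewrite -addSnnS [LHS]big_ltn ?(leqW lt_i) // [RHS]big_ltn //.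
have -> : \prod_(i.+1 <= k < (i.+1 + d).+1)
     (x k (bump i.+1 k) + x k (bump i.+1 k.-1)) =
   (x i.+1 i.+2 + x i.+1 i) *
     \prod_(i.+2 <= k < (i.+1 + d).+1) (x k k.+1 + x k k).
  rewrite big_ltn //=; congr (_ * _).
    by rewrite bump_geq // bump_ltn.
  apply: eq_big_nat => -[//|k] /andP[lt_ik _].
  by rewrite !bump_geq // ltnW.
have -> : \sum_(i.+2 <= m < (i.+1 + d).+2) \prod_(i.+1 <= k < (i.+1 + d).+1)
     (x k (bump m k) + x k (bump m k.-1)) =
   (x i.+1 i.+1 + x i.+1 i) *
     \prod_(i.+2 <= k < (i.+1 + d).+1) (x k k.+1 + x k k).
  rewrite -IHd mulr_sumr; apply: eq_big_nat => m /andP[lt_im _].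
  by rewrite big_ltn //= (bump_ltn lt_im) (bump_ltn (ltnW lt_im)).
by rewrite -mulrDl addrACA addRR addr0.
Qed.

(* Cochain-level factors of the product
   d(x_0) ... d(x_(i-1)) . x_i . d(x_(i+1)) ... evaluated on the sequence of
   vertices 0, 1, 2, ... with m omitted. *)
Definition cup_factor x (i m k : nat) : R :=
  if (k < i)%N then x k (bump m k.+1) + x k (bump m k)
  else if k == i then x k (bump m k)
  else x k (bump m k) + x k (bump m k.-1).

(** All factors but x_i are already coboundaries. The faces m <= i contribute x_i at vertex i+1, the
    faces m > i contribute x_i at vertex i, and together they form d(x_i). *)
Lemma leibniz x (i N : nat) : (i < N)%N ->
  \sum_(0 <= m < N.+1) \prod_(0 <= k < N) cup_factor x i m k =
  \prod_(0 <= k < N) (x k k.+1 + x k k).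
Proof.
move=> lt_iN.
have split3 (f : nat -> R) : \prod_(0 <= k < N) f k =
    \prod_(0 <= k < i) f k * (f i * \prod_(i.+1 <= k < N) f k).
  by rewrite (big_cat_nat (n := i)) ?(ltnW lt_iN) //= (big_ltn lt_iN).
have facL m : \prod_(0 <= k < i) cup_factor x i m k =
    \prod_(0 <= k < i) (x k (bump m k.+1) + x k (bump m k)).
  by apply: eq_big_nat => k /andP[_ lt_ki]; rewrite /cup_factor lt_ki.
have facR m : \prod_(i.+1 <= k < N) cup_factor x i m k =
    \prod_(i.+1 <= k < N) (x k (bump m k) + x k (bump m k.-1)).
  apply: eq_big_nat => k /andP[lt_ik _].
  by rewrite /cup_factor ltnNge (ltnW lt_ik) /= gtn_eqF.
have facI m : cup_factor x i m i = x i (bump m i).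
  by rewrite /cup_factor ltnn eqxx.
rewrite split3 (big_cat_nat (n := i.+1)) ?(leqW lt_iN) //=.
set A := \prod_(0 <= k < i) (x k k.+1 + x k k).
set B := \prod_(i.+1 <= k < N) (x k k.+1 + x k k).
have -> : \sum_(0 <= m < i.+1) \prod_(0 <= k < N) cup_factor x i m k =
    A * (x i i.+1 * B).
  rewrite /A -leibniz_left mulr_suml; apply: eq_big_nat => m.
  rewrite ltnS => /andP[_ le_mi].
  rewrite split3 facL facI facR (bump_geq le_mi); congr (_ * (_ * _)).
  apply: eq_big_nat => -[//|k] /andP[lt_ik _] /=.
  by rewrite !bump_geq // (leq_trans le_mi) // ltnW.
have -> : \sum_(i.+1 <= m < N.+1) \prod_(0 <= k < N) cup_factor x i m k =
    A * (x i i * B).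
  rewrite /B; case: N lt_iN split3 facR {facL facI B} => // N.
  rewrite ltnS => le_iN split3 facR.
  rewrite -(subnKC le_iN) -leibniz_right (subnKC le_iN) mulrA mulr_sumr.
  apply: eq_big_nat => m /andP[lt_im _].
  rewrite split3 facR mulrA /cup_factor ltnn eqxx (bump_ltn lt_im).
  congr (_ * _ * _); apply: eq_big_nat => k /andP[_ lt_ki].
  by rewrite lt_ki !bump_ltn // (leq_trans _ lt_im) // ltnS ltnW.
by rewrite -mulrDr -mulrDl.
Qed.
End Leibniz.

(** * Cup products on the Kuhn triangulation of the grid *)

Section CupSum.
Context {R : comNzRingType} (addRR : forall x : R, x + x = 0) {N n : nat}.
Local Notation vertex := ('I_N.+1 -> nat).
Implicit Types (a : 'I_N.+1 -> vertex -> R) (v : {ffun 'I_N.+1 -> 'I_n.+1}).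
Implicit Types (s : 'S_N.+1).

(* The l-th vertex of the Kuhn simplex of the unit cube at v in which
   coordinate j is incremented at time s j. *)
Definition staircase v s (l : nat) : vertex :=
  fun j => (v j + (s j < l))%N.

Definition cup_sum a : R :=
  \sum_(v : {ffun 'I_N.+1 -> 'I_n.+1}) \sum_(s : 'S_N.+1)
    \prod_(k < N.+1) (a k (staircase v s k.+1) + a k (staircase v s k)).

Definition on_stairs a v s (k l : nat) : R :=
  a (inord k) (staircase v s l).

Definition face_term a (i m : nat) v s : R :=
  \prod_(0 <= k < N.+1) cup_factor (on_stairs a v s) i m k.

Lemma staircase_tperm v s (m l : nat) :
  (0 < m < N.+1)%N -> l != m ->
  staircase v (s * tperm (inord m.-1) (inord m)) l = staircase v s l.
Proof.
move=> /andP[m_gt0 lt_mN] neq_lm; apply/funext => j.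
have lt_m : (m < l)%N = (m.-1 < l)%N.
  case: m m_gt0 neq_lm {lt_mN} => //= m _ neq_lm.
  by rewrite [RHS]leq_eqVlt eq_sym (negPf neq_lm).
have lt_mN' := leq_ltn_trans (leq_pred m) lt_mN.
rewrite /staircase permM; congr (_ + nat_of_bool _)%N.
by case: tpermP => [->|->|//]; rewrite !inordK.
Qed.

(** Exchanging the increments made at times m-1 and m moves only the m-th vertex, so two simplices
    of the same cube share this facet; they have opposite parity and cancel. *)
Lemma face_term_interior a (i m : nat) v :
  (0 < m < N.+1)%N -> \sum_(s : 'S_N.+1) face_term a i m v s = 0.
Proof.
move=> mN; set t := tperm (inord m.-1) (inord m) : 'S_N.+1.
have face_t s : face_term a i m v (s * t) = face_term a i m v s.
  apply: eq_big_nat => k _.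
  by rewrite /cup_factor /on_stairs !staircase_tperm // eq_sym neq_bump.
have odd_t : odd_perm t.
  case/andP: mN => m_gt0 lt_mN; rewrite odd_tperm -val_eqE /= !inordK //.
    by case: m m_gt0 {lt_mN t face_t} => // m _; rewrite neq_ltn ltnSn.
  exact: leq_ltn_trans (leq_pred m) lt_mN.
rewrite (bigID (fun s => odd_perm s)) /=.
have -> : \sum_(s : 'S_N.+1 | odd_perm s) face_term a i m v s =
    \sum_(s : 'S_N.+1 | ~~ odd_perm s) face_term a i m v s.
  rewrite (reindex_inj (mulIg t)) /=; apply: eq_big => s.
    by rewrite odd_permM odd_t addbT.
  by rewrite face_t.
exact: addRR.
Qed.

Section Faces.
Context (a : 'I_N.+1 -> vertex -> R) (i : 'I_N.+1).
(** These conditions hold when [a i] is the difference of two normalized labels and the other labels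
    are normalized. *)
Hypothesis a_i : forall u, u i = 0%N \/ u i = n.+1 -> a i u = 0.
Hypothesis a_face : forall (k : 'I_N.+1) u u', k != i ->
  u k = u' k -> u k = 0%N \/ u k = n.+1 -> a k u = a k u'.

(** A facet inside the grid face [u_j = t] kills the j-th factor: it is a value of [a i] on that
    face if j = i, and otherwise the difference of two equal labels. *)
Lemma face_term_boundary (m : nat) v s (j : 'I_N.+1) (t : nat) :
  (m <= N.+1)%N -> t = 0%N \/ t = n.+1 ->
  (forall l, (l <= N.+1)%N -> l != m -> staircase v s l j = t) ->
  face_term a i m v s = 0.
Proof.
move=> le_mN t0n face; rewrite /face_term big_mkord (bigD1 j) //=.
suff -> : cup_factor (on_stairs a v s) i m j = 0 by rewrite mul0r.
have {}face l : (l <= N)%N -> staircase v s (bump m l) j = t.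
  move=> le_lN; apply: face; last by rewrite eq_sym neq_bump.
  by rewrite /bump; case: (m <= l)%N => //=; apply: leqW.
have le_jN : (j <= N)%N by rewrite -ltnS.
rewrite /cup_factor /on_stairs inord_val.
case: ltngtP => [lt_ji|lt_ij|/val_inj eq_ji].
- have neq_ji : j != i by rewrite -val_eqE /= neq_ltn lt_ji.
  have ? : (j.+1 <= N)%N by rewrite (leq_trans lt_ji) // -ltnS.
  by rewrite (a_face j _ (staircase v s (bump m j))) ?addRR ?face.
- have neq_ji : j != i by rewrite -val_eqE /= neq_ltn lt_ij orbT.
  have ? : (j.-1 <= N)%N := leq_trans (leq_pred _) le_jN.
  by rewrite (a_face j _ (staircase v s (bump m j.-1))) ?addRR ?face.
by rewrite eq_ji; apply: a_i; rewrite -eq_ji face.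
Qed.

(* The facet of the simplex p opposite to its first vertex is the facet of
   shift_cube p opposite to its last vertex, unless it lies on the boundary of
   the grid, where the wrap-around of ordS only serves to get a bijection. *)
Definition shift_cube (p : {ffun 'I_N.+1 -> 'I_n.+1} * 'S_N.+1) :
    {ffun 'I_N.+1 -> 'I_n.+1} * 'S_N.+1 :=
  ([ffun j => if p.2 j == ord0 then ordS (p.1 j) else p.1 j],
   (p.2 * perm (@ord_pred_inj N.+1))%g).

Lemma shift_cube_inj : injective shift_cube.
Proof.
move=> [v s] [v' s'] [/ffunP eq_v /mulIg eq_s]; rewrite {}eq_s in eq_v *.
congr (_, _); apply/ffunP => j; have := eq_v j; rewrite !ffunE /=.
by case: ifP => // _ /ordS_inj.
Qed.

Lemma staircase_shift v s (l : nat) : (l <= N)%N ->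
  ((v ((s^-1)%g ord0)).+1 < n.+1)%N ->
  staircase (shift_cube (v, s)).1 (shift_cube (v, s)).2 l = staircase v s l.+1.
Proof.
move=> le_lN lt_vn; apply/funext => j.
rewrite /staircase /= ffunE permM permE /=.
case: eqP => [sj0|/eqP sj0].
  have jE : j = (s^-1)%g ord0 by rewrite -sj0 permK.
  rewrite -jE in lt_vn; rewrite sj0 /=.
  by rewrite !modn_small // ltnNge le_lN addn0 addn1.
congr (_ + nat_of_bool _)%N; case: (s j) sj0 => -[|q] //= lt_qN _.
by rewrite modnDr modn_small // ltnW.
Qed.

Lemma face_term_shift v s :
  face_term a i N.+1 (shift_cube (v, s)).1 (shift_cube (v, s)).2 =
  face_term a i 0 v s.
Proof.
set j := (s^-1)%g ord0; have sj : s j = ord0 by rewrite permKV.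
have [lt_vn|ge_vn] := ltnP (v j).+1 n.+1.
  apply: eq_big_nat => k /andP[_ lt_kN]; rewrite /cup_factor /on_stairs.
  have le_kN : (k <= N)%N by [].
  have le_pkN := leq_trans (leq_pred k) le_kN.
  case: ltngtP => [lt_ki|lt_ik|_].
  - have lt_kN' : (k < N)%N by rewrite (leq_trans lt_ki) // -ltnS.
    rewrite !(bump_geq (leq0n _)) !bump_ltn ?ltnS //.
    by rewrite !staircase_shift // ltnW.
  - by rewrite !(bump_geq (leq0n _)) !bump_ltn ?ltnS // !staircase_shift.
  - by rewrite !(bump_geq (leq0n _)) !bump_ltn ?ltnS // !staircase_shift.
(* In the last layer the facet lies on [u_j = n+1], while the shifted one has wrapped around to
   [u_j = 0]; both terms vanish. *)
have vj : v j = n :> nat by apply/eqP; rewrite eqn_leq -ltnS ltn_ord -ltnS.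
rewrite (@face_term_boundary 0 v s j n.+1) //; last 2 first.
- by right.
- by case=> // l _ _; rewrite /staircase sj vj addn1.
apply: (@face_term_boundary _ _ _ j 0); [by [] | by left |] => l le_lN neq_lN.
have {}le_lN : (l <= N)%N by rewrite -ltnS ltn_neqAle neq_lN.
rewrite /staircase /= ffunE permM permE sj eqxx /= vj modnn add0n.
by rewrite modn_small // ltnNge le_lN.
Qed.

(* Discrete Stokes formula: the sum is that of a coboundary, whose interior
   facets cancel in pairs and whose boundary facets contribute 0. *)
Lemma cup_sum0 : cup_sum a = 0.
Proof.
have -> : cup_sum a = \sum_(v : {ffun 'I_N.+1 -> 'I_n.+1}) \sum_(s : 'S_N.+1)
    \sum_(0 <= m < N.+2) face_term a i m v s.
  apply: eq_bigr => v _; apply: eq_bigr => s _.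
  rewrite (leibniz addRR _ _ _ (ltn_ord i)) big_mkord; apply: eq_bigr => k _.
  by rewrite /on_stairs inord_val.
under eq_bigr do rewrite exchange_big /=.
rewrite exchange_big /= big_ltn // big_nat_recr //=.
rewrite [X in _ + (X + _)]big1_seq ?add0r; last first.
  move=> m /andP[_]; rewrite mem_index_iota => mN.
  by apply: big1 => v _; apply: face_term_interior.
rewrite !pair_big /= [X in _ + X](reindex_inj shift_cube_inj).
rewrite [X in _ + X](eq_bigr (fun p => face_term a i 0 p.1 p.2)) ?addRR //.
by move=> -[v s] _; rewrite face_term_shift.
Qed.
End Faces.

Definition replace a (i : 'I_N.+1) (f : vertex -> R) : 'I_N.+1 -> vertex -> R :=
  fun k => if k == i then f else a k.

Lemma cup_sum_replaceD a (i : 'I_N.+1) (f g : vertex -> R) :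
  cup_sum (replace a i (fun u => f u + g u)) =
  cup_sum (replace a i f) + cup_sum (replace a i g).
Proof.
rewrite /cup_sum -big_split /=; apply: eq_bigr => v _.
rewrite -big_split /=; apply: eq_bigr => s _.
rewrite [LHS](bigD1 i) // [X in _ = X + _](bigD1 i) //.
rewrite [X in _ = _ + X](bigD1 i) //=.
rewrite /replace eqxx addrACA mulrDl.
by congr (_ * _ + _ * _); apply: eq_bigr => k /negPf ->.
Qed.

Definition normalized a := forall (k : 'I_N.+1) u,
  (u k = 0%N -> a k u = 0) /\ (u k = n.+1 -> a k u = 1).

Definition step_cochain (k : 'I_N.+1) (u : vertex) : R := (0 < u k)%N%:R.

(** The label [0 < u_k] changes along the k-th edge only if v_k = 0 and coordinate k is incremented
    at time k. A single simplex survives: the identity permutation in the cube at the origin. *)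
Lemma cup_sum_step : cup_sum step_cochain = 1.
Proof.
have factorE v s (k : 'I_N.+1) :
    step_cochain k (staircase v s k.+1) + step_cochain k (staircase v s k) =
    ((v k == ord0) && (s k == k))%:R.
  rewrite /step_cochain /staircase -!val_eqE /= !addn_gt0 !lt0b ltnS.
  case: (posnP (v k)) => _ /=; last by rewrite addRR.
  by case: ltngtP => _; rewrite ?addr0 ?add0r ?addRR.
rewrite /cup_sum.
under eq_bigr do under eq_bigr do under eq_bigr do rewrite factorE.
rewrite (bigD1 [ffun=> ord0]) //= [X in _ + X]big1 ?addr0; last first.
  move=> v vn0; apply: big1 => s _.
  suff [k vk] : exists k, v k != ord0.
    by rewrite (bigD1 k) //= (negPf vk) mul0r.
  apply/existsP; rewrite -negb_forall; apply: contra vn0 => /forallP v0.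
  by apply/eqP/ffunP => k; rewrite ffunE; apply/eqP.
rewrite (bigD1 1%g) //= [X in _ + X]big1 ?addr0; last first.
  move=> s sn1; suff [k sk] : exists k, s k != k.
    by rewrite (bigD1 k) //= (negPf sk) andbF mul0r.
  apply/existsP; rewrite -negb_forall; apply: contra sn1 => /forallP s1.
  by apply/eqP/permP => k; rewrite perm1; apply/eqP.
by apply: big1 => k _; rewrite ffunE perm1 !eqxx.
Qed.

(** The labels are exchanged for step cochains one at a time. By multilinearity each exchange
    changes the sum by a cup sum whose j-th label vanishes on both j-faces, hence by 0. *)
Lemma cup_sum_normalized a : normalized a -> cup_sum a = 1.
Proof.
move=> a_nrm.
have step_nrm : normalized step_cochain.
  by move=> k u; rewrite /step_cochain; split=> ->.
pose mix i (k : 'I_N.+1) := if (k < i)%N then step_cochain k else a k.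
have mix_nrm i : normalized (mix i).
  by move=> k u; rewrite /mix; case: ifP => _; [exact: step_nrm|exact: a_nrm].
suff mixE i : (i <= N.+1)%N -> cup_sum (mix i) = cup_sum (mix 0%N).
  have -> : a = mix 0%N by apply/funext.
  rewrite -(mixE N.+1) // -[RHS]cup_sum_step; congr cup_sum.
  by apply/funext => k; rewrite /mix ltn_ord.
elim: i => // i IHi lt_iN; rewrite -IHi ?(ltnW lt_iN) //.
pose j : 'I_N.+1 := Ordinal lt_iN.
have mixi : mix i = replace (mix i) j (mix i j).
  by apply/funext => k; rewrite /replace; case: eqP => [->|].
have mixSi : mix i.+1 = replace (mix i) j (step_cochain j).
  apply/funext => k; rewrite /replace /mix ltnS leq_eqVlt -val_eqE /=.
  by case: eqP => [kj|//] /=; congr step_cochain; apply/val_inj.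
apply/esym/(addIr (cup_sum (mix i.+1))).
rewrite addRR mixSi [in X in X + _]mixi -cup_sum_replaceD.
apply: (@cup_sum0 _ j) => [u u0n|k u u' neq_kj eq_u u0n]; rewrite /replace.
  have [a0 a1] := mix_nrm i j u; have [s0 s1] := step_nrm j u.
  rewrite eqxx; case: u0n => u_j; first by rewrite a0 // s0 // addr0.
  by rewrite a1 // s1.
have [a0 a1] := mix_nrm i k u; have [a0' a1'] := mix_nrm i k u'.
rewrite (negPf neq_kj); case: u0n => u_k.
  by rewrite a0 ?a0' // -eq_u.
by rewrite a1 ?a1' // -eq_u.
Qed.
End CupSum.

(** Over ['F_2] the cup sum is 1, so some term is nonzero; each factor of that term records a change
    of label k along the k-th edge. *)
Lemma cubical_sperner (N n : nat) (lab : 'I_N.+1 -> ('I_N.+1 -> nat) -> bool) :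
  (forall k u, u k = 0%N -> ~~ lab k u) ->
  (forall k u, u k = n.+1 -> lab k u) ->
  exists (v : {ffun 'I_N.+1 -> 'I_n.+1}) (s : 'S_N.+1),
    forall k : 'I_N.+1, lab k (staircase v s k.+1) != lab k (staircase v s k).
Proof.
move=> lab0 lab1.
have addFF (x : 'F_2) : x + x = 0 := addrr_pchar2 (pchar_Fp (isT : prime 2)) x.
pose a k u : 'F_2 := (lab k u)%:R.
have a_nrm : normalized (n := n) a.
  move=> k u; rewrite /a; split; first by move/lab0/negPf->.
  by move/lab1->.
have := cup_sum_normalized addFF _ a_nrm.
apply: contraPP => noVS; apply/eqP; rewrite eq_sym.
suff -> : cup_sum (n := n) a = 0 by rewrite oner_eq0.
apply: big1 => v _; apply: big1 => s _.
have [k labk] : exists k : 'I_N.+1,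
    lab k (staircase v s k.+1) = lab k (staircase v s k).
  apply: contrapT => nok; apply: noVS; exists v, s => k.
  by apply/eqP => labk; apply: nok; exists k.
by rewrite (bigD1 k) //= /a labk addFF mul0r.
Qed.

(** * From labels to continuous paths *)

Section RealLemmas.
Context {R : realType}.

Definition clamp (t : R) : R := Num.max 0 (Num.min t 1).

Lemma clamp_itv t : clamp t \in `[0, 1].
Proof.
by rewrite in_itv /= /clamp le_max lexx /= ge_max ler01 ge_min lexx orbT.
Qed.

Lemma clamp_id t : t \in `[0, 1] -> clamp t = t.
Proof.
by rewrite in_itv /= => /andP[t0 t1]; rewrite /clamp min_l // max_r.
Qed.

Lemma continuous_clamp : continuous clamp.
Proof.
move=> t; apply: (@continuous_max _ R (fun=> 0) (fun t => Num.min t 1)).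
  exact: cvg_cst.
apply: (@continuous_min _ R id (fun=> 1)); [exact: cvg_id|exact: cvg_cst].
Qed.

Lemma continuous_row (N : nat) (T : topologicalType) (F : T -> 'I_N -> R) :
  (forall j, continuous (fun x => F x j)) ->
  continuous (fun x => \row_j F x j : 'rV[R]_N).
Proof.
move=> F_cont x A /nbhs_ballP[e /= e0 eA].
have Fnear : \forall y \near x, forall j, ball (F x j) e (F y j).
  by apply: filter_forall => j; exact: F_cont (nbhsx_ballx _ _ e0).
apply: filterS Fnear => y Fy; apply: eA; split=> // i j; rewrite !mxE.
exact: Fy.
Qed.

Definition cube_clamp (N : nat) (x : 'rV[R]_N) : 'rV[R]_N :=
  \row_j clamp (x ord0 j).

Lemma cube_clamp_cube (N : nat) (x : 'rV[R]_N) : unit_cube (cube_clamp N x).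
Proof. by move=> j; rewrite mxE clamp_itv. Qed.

Lemma cube_clamp_id (N : nat) (x : 'rV[R]_N) :
  unit_cube x -> cube_clamp N x = x.
Proof. by move=> x01; apply/rowP => j; rewrite mxE clamp_id. Qed.

Lemma continuous_cube_clamp (N : nat) : continuous (cube_clamp N).
Proof.
apply: continuous_row => j x.
apply: (@continuous_comp _ _ _ (fun x : 'rV[R]_N => x ord0 j)).
  exact: coord_continuous.
exact: continuous_clamp.
Qed.

Lemma continuous_within_comp (T U V : topologicalType) (D : set U)
    (f : U -> V) (g : T -> U) :
  {within D, continuous f} -> continuous g -> (forall x, D (g x)) ->
  continuous (f \o g).
Proof.
move=> /subspace_continuousP f_cont g_cont gD x.
move=> A /(f_cont _ (gD x)) fA.
rewrite /nbhs /=; near=> y.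
have : D (g y) -> A (f (g y)) by near: y; exact: g_cont x _ fA.
by apply; exact: gD.
Unshelve. all: by end_near. Qed.

Lemma zero_between (h : R -> R) (s t : R) : continuous h ->
  s \in `[0, 1] -> t \in `[0, 1] -> h s <= 0 -> 0 <= h t ->
  exists2 c, c \in `[0, 1] & h c = 0.
Proof.
move=> h_cont s01 t01 hs ht.
(* Passing to -h exchanges the roles of s and t. *)
wlog le_st : h s t h_cont s01 t01 hs ht / s <= t.
  move=> wl; have [/wl|/ltW le_ts] := leP s t; first by apply.
  have [] := wl (fun x => - h x) t s; rewrite ?oppr_cp0 ?oppr_le0 ?oppr_ge0 //.
    by move=> x; apply: continuousN; exact: h_cont.
  by move=> c c01 /eqP; rewrite oppr_eq0 => /eqP; exists c.
have [||c] := @IVT R h s t 0 le_st.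
- exact: continuous_subspaceT.
- by rewrite ge_min hs /= le_max ht orbT.
move=> cst hc; exists c => //; move: s01 t01 cst; rewrite !in_itv /=.
move=> /andP[s0 _] /andP[_ t1] /andP[sc ct].
by rewrite (le_trans s0 sc) (le_trans ct t1).
Qed.

End RealLemmas.

(** * Paths avoiding the zeros of a function *)

Section Linked.
Context {R : realType} {N : nat}.
Implicit Types (f : 'rV[R]_N -> R) (x y : 'rV[R]_N) (j : 'I_N).

(** Continuity is required on all of R so that paths can be reparametrized and concatenated without
    subspace topologies. *)
Definition linked f j x : Prop := exists gamma : R -> 'rV[R]_N,
  [/\ continuous gamma,
      forall t, t \in `[0, 1] -> unit_cube (gamma t),
      gamma 0 ord0 j = 0,
      gamma 1 = x &
      forall t, t \in `[0, 1] -> f (gamma t) != 0].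

Lemma linked_face f j x :
  unit_cube x -> x ord0 j = 0 -> f x != 0 -> linked f j x.
Proof.
by move=> x01 xj fx; exists (fun=> x); split=> //; exact: cst_continuous.
Qed.

Lemma linked_segment f j x y :
  (forall t, t \in `[0, 1] ->
    unit_cube (x + t *: (y - x)) /\ f (x + t *: (y - x)) != 0) ->
  linked f j x -> linked f j y.
Proof.
move=> seg [g [g_cont g_cube g0 g1 fg]].
(* Concatenation in one formula: up to t = 1/2 the second term is 0, and afterwards the first one
   stays at g 1 = x. *)
pose g' t := g (Num.min (2 * t) 1) + Num.max 0 (2 * t - 1) *: (y - x).
have cont2 : continuous (fun t : R => 2 * t).
  by move=> t; apply: cvgMl_tmp; exact: cvg_id.
have g'E t : t \in `[0, 1] -> exists2 s, s \in `[0, 1] &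
    g' t = g s \/ g' t = x + s *: (y - x).
  rewrite in_itv /= => /andP[t0 t1]; rewrite /g'.
  have [le_t|/ltW ge_t] := leP (2 * t) 1.
    exists (2 * t); first by rewrite in_itv /= le_t mulr_ge0.
    by left; rewrite max_l ?scale0r ?addr0 // subr_le0.
  exists (2 * t - 1); first by rewrite in_itv /=; lra.
  by right; rewrite g1 max_r // subr_ge0.
exists g'; split.
- have min_cont : continuous (fun t : R => Num.min (2 * t) 1).
    move=> t; apply: (@continuous_min _ R (fun t => 2 * t) (fun=> 1)).
      exact: cont2.
    exact: cvg_cst.
  have max_cont : continuous (fun t : R => Num.max 0 (2 * t - 1)).
    move=> t; apply: (@continuous_max _ R (fun=> 0) (fun t => 2 * t - 1)).
      exact: cvg_cst.
    by apply: cvgB; [exact: cont2|exact: cvg_cst].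
  have g_min_cont : continuous (g \o (fun t => Num.min (2 * t) 1)).
    by move=> t; apply: continuous_comp; [exact: min_cont|exact: g_cont].
  move=> t; apply: cvgD; first exact: g_min_cont.
  by apply: cvgZr_tmp; exact: max_cont.
- move=> t /g'E[s s01 [->|->]]; first exact: g_cube.
  by have [] := seg _ s01.
- rewrite /g' mulr0 sub0r min_l ?ler01 // max_l ?scale0r ?addr0 ?g0 //.
- rewrite /g' mulr1 min_r ?ler1n // max_r; last by lra.
  by rewrite g1 (_ : 2 - 1 = 1 :> R) ?scale1r ?subrKC //; lra.
- move=> t /g'E[s s01 [->|->]]; first exact: fg.
  by have [] := seg _ s01.
Qed.

End Linked.

(** * The functions phi_j - x_j on the cube *)

Section FixedPoint.
Context {R : realType} {N : nat} (phi : 'rV[R]_N -> 'rV[R]_N).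
Hypothesis phi_cont : {within @unit_cube R N, continuous phi}.

(** Clamping the argument of phi makes the function continuous on the whole space and leaves it
    unchanged on the cube. *)
Definition displacement (j : 'I_N) (x : 'rV[R]_N) : R :=
  phi (cube_clamp N x) ord0 j - x ord0 j.

Lemma displacementE j x :
  unit_cube x -> displacement j x = phi x ord0 j - x ord0 j.
Proof. by move=> x01; rewrite /displacement cube_clamp_id. Qed.

Lemma continuous_displacement j : continuous (displacement j).
Proof.
move=> x; apply: (@continuousB _ _ _ (fun x => phi (cube_clamp N x) ord0 j)
  (fun x : 'rV[R]_N => x ord0 j)); last exact: coord_continuous.
apply: (@continuous_comp _ _ _ (phi \o cube_clamp N)
  (fun x : 'rV[R]_N => x ord0 j)); last exact: coord_continuous.
apply: continuous_within_comp phi_cont _ _ _.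
  exact: continuous_cube_clamp.
exact: cube_clamp_cube.
Qed.

(** Along a path between the opposite j-faces the displacement takes a value <= 0 and a value >= 0,
    so it vanishes somewhere. *)
Lemma linked_not_opposite j x : condC phi j \/ condE phi j ->
  linked (displacement j) j x -> x ord0 j != 1.
Proof.
move=> CE [g [g_cont g_cube g0 g1 fg]]; apply/eqP => xj.
have i0 : 0 \in `[0, 1 : R] by rewrite in_itv /= lexx ler01.
have i1 : 1 \in `[0, 1 : R] by rewrite in_itv /= lexx ler01.
have h_cont : continuous (displacement j \o g).
  move=> t; apply: continuous_comp; first exact: g_cont.
  exact: continuous_displacement.
suff [s [t [s01 t01 hs ht]]] : exists s t, [/\ s \in `[0, 1], t \in `[0, 1],
    (displacement j \o g) s <= 0 & 0 <= (displacement j \o g) t].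
  have [c c01 hc] := zero_between _ _ _ h_cont s01 t01 hs ht.
  by have /eqP := fg c c01; apply; exact: hc.
have gE t : t \in `[0, 1] ->
    (displacement j \o g) t = phi (g t) ord0 j - g t ord0 j.
  by move=> /g_cube t01; rewrite /= displacementE.
have g1j : g 1 ord0 j = 1 by rewrite g1.
case: CE => [C|E].
  have phi01 t : t \in `[0, 1] -> g t ord0 j = 0 \/ g t ord0 j = 1 ->
      0 <= phi (g t) ord0 j <= 1.
    move=> t01 gt; have := C (phi (g t) ord0 j); rewrite /= in_itv /=; apply.
    by exists (g t) => //; case: gt; [left|right]; split=> //; exact: g_cube.
  (* Under (C) the endpoints of the path have the required signs. *)
  exists 1, 0; split=> //; rewrite gE //.
    rewrite g1 xj subr_le0 -g1.
    by have /andP[] := phi01 1 i1 (or_intror g1j).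
  rewrite g0 subr0.
  by case/andP: (phi01 0 i0 (or_introl g0)).
have g_path : cube_path g by split=> //; exact: continuous_subspaceT.
(* Under (E), points of the path where phi_j is 0 and 1 serve, since the j-th coordinate stays in
   [0,1]. *)
have [_ [s s01 <-] phis] := E g g_path g0 g1j 0 i0.
have [_ [t t01 <-] phit] := E g g_path g0 g1j 1 i1.
exists s, t; split=> //; rewrite gE // ?phis ?phit.
  by have := g_cube s s01 j; rewrite in_itv /= sub0r oppr_le0 => /andP[].
by have := g_cube t t01 j; rewrite in_itv /= subr_ge0 => /andP[].
Qed.

Lemma compact_unit_cube : compact (@unit_cube R N).
Proof.
apply: (@rV_compact R N (fun=> `[0, 1]%classic)) => _; exact: segment_compact.
Qed.

(** Without fixed points, the open sets where some displacement is nonzero cover the compact cube; d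
    is a Lebesgue number of this cover. *)
Lemma lebesgue_number : (forall x, unit_cube x -> phi x <> x) ->
  exists2 d : R, 0 < d & forall x, unit_cube x ->
    exists j, forall y, ball x d y -> displacement j y != 0.
Proof.
move=> nofix.
pose P (d : R) x := exists j, forall y, ball x d y -> displacement j y != 0.
have /compact_near_coveringP cov := compact_unit_cube.
have : \forall d \near 0^'+, @unit_cube R N `<=` P d.
  apply: cov => x x01.
  have [j fx] : exists j, displacement j x != 0.
    apply: contrapT => nj; apply: (nofix x x01); apply/rowP => j.
    apply/eqP; rewrite -subr_eq0 -displacementE //; apply/negP => /negP fx.
    by apply: nj; exists j.
  have : \forall y \near x, displacement j y != 0.
    have : nbhs (displacement j x) [set r | r != 0].
      by apply: open_nbhs_nbhs; split => //; exact: open_neq.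
    exact: continuous_displacement.
  move=> /nbhs_ballP[e /= e0 fe].
  (* Halving e leaves room for the ball of radius d around x' inside the ball of radius e around
     x. *)
  near=> x' d.
  have xx' : ball x (e / 2) x'.
    by near: x'; apply: nbhsx_ballx; rewrite divr_gt0.
  have de : d <= e / 2 by near: d; apply: nbhs_right_ltW; rewrite divr_gt0.
  by exists j => y x'y; apply: fe; apply: ball_split xx' _; exact: le_ball x'y.
move=> dP; near (0 : R)^'+ => d.
by exists d; [near: d; exact: nbhs_right_gt | near: d].
Unshelve. all: by end_near. Qed.

End FixedPoint.

(** * The grid, and the conclusion *)

Section Grid.
Context {R : realType} {N : nat} (n : nat).

Definition grid_point (u : 'I_N -> nat) : 'rV[R]_N :=
  \row_j ((u j)%:R / n.+1%:R).

Lemma grid_point_cube (u : 'I_N -> nat) :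
  (forall j, (u j <= n.+1)%N) -> unit_cube (grid_point u).
Proof.
move=> le_un j; rewrite in_itv /= mxE divr_ge0 //=.
by rewrite ler_pdivrMr // mul1r ler_nat.
Qed.

End Grid.

Lemma convex_segment (R : realType) (lo hi a b t : R) : t \in `[0, 1] ->
  lo <= a <= hi -> lo <= b <= hi -> lo <= a + t * (b - a) <= hi.
Proof.
rewrite in_itv /= => /andP[t0 t1] /andP[? ?] /andP[? ?].
by apply/andP; split; nra.
Qed.

Theorem corollary3p1 (R : realType) (N : nat) (hN : (0 < N)%N)
    (phi : 'rV[R]_N -> 'rV[R]_N)
    (phi_cont : {within @unit_cube R N, continuous phi})
    (phi_CE : forall j : 'I_N, condC phi j \/ condE phi j) :
  exists x : 'rV[R]_N, unit_cube x /\ phi x = x.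
Proof.
apply: contrapT => nofix.
have [d d0 leb] : exists2 d : R, 0 < d & forall x, unit_cube x ->
    exists j, forall y, ball x d y -> displacement phi j y != 0.
  by apply: lebesgue_number => // x x01 phix; apply: nofix; exists x.
case: N hN phi phi_cont phi_CE nofix leb => // N _.
move=> phi phi_cont phi_CE nofix leb.
have [n n_d] : exists n, n.+1%:R^-1 < d.
  near \oo => n; exists n; near: n.
  exact: near_infty_natSinv_lt (PosNum d0).
(* The test [u k != 0] covers the vertices of [x_k = 0] at which the displacement vanishes: these
   are not linked. *)
pose lab (k : 'I_N.+1) (u : 'I_N.+1 -> nat) :=
  (u k != 0)%N && ~~ `[< linked (displacement phi k) k (grid_point n u) >].
have [||v [s lab_vs]] := @cubical_sperner N n lab.
- by move=> k u uk; rewrite /lab uk.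
- move=> k u uk; rewrite /lab uk /=; apply/asboolPn.
  move=> /(linked_not_opposite _ phi_cont _ _ (phi_CE k)).
  by rewrite mxE uk divff ?eqxx // pnatr_eq0.
pose x : 'rV[R]_N.+1 := grid_point n (fun j => v j).
have [j fj] : exists j, forall y, ball x d y -> displacement phi j y != 0.
  by apply: leb; apply: grid_point_cube => j; apply: ltnW.
pose cell (y : 'rV[R]_N.+1) := forall i,
  x ord0 i <= y ord0 i <= (v i).+1%:R / n.+1%:R.
have cell_cube y : cell y -> unit_cube y.
  move=> cy i; have /andP[xy yv] := cy i; rewrite in_itv /=.
  rewrite (le_trans _ xy) ?mxE ?divr_ge0 //=.
  by rewrite (le_trans yv) // ler_pdivrMr // mul1r ler_nat.
(* Balls are those of the sup norm, so a side 1/(n+1) < d suffices. *)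
have cell_ball y : cell y -> ball x d y.
  move=> cy; split=> // i0 i; rewrite (ord1 i0); have /andP[xy yv] := cy i.
  rewrite /ball /= ler0_norm ?subr_le0 // opprB (le_lt_trans _ n_d) //.
  rewrite lerBlDr (le_trans yv) // mxE -[X in X + _]mul1r -mulrDl.
  by rewrite addrC natr1.
have cell_stair l : cell (grid_point n (staircase v s l)).
  move=> i; rewrite !mxE /staircase !ler_pM2r ?invr_gt0 // !ler_nat.
  by rewrite leq_addr -[(v i).+1]addn1 leq_add2l leq_b1.
suff lab_eq l l' : lab j (staircase v s l') -> lab j (staircase v s l).
  have := lab_vs j; apply/negP; rewrite negbK; apply/eqP.
  by apply/idP/idP; apply: lab_eq.
apply: contraLR; rewrite /lab !negb_and !negbK => uj; apply/orP; right.
apply/asboolP.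
apply: (@linked_segment _ _ _ _ (grid_point n (staircase v s l))).
  move=> t t01; set y := _ + _.
  have cy : cell y.
    move=> i.
    have := convex_segment _ _ _ _ _ _ t01 (cell_stair l i) (cell_stair l' i).
    by rewrite /y !mxE.
  by split; [exact: cell_cube|exact/fj/cell_ball].
(* A vertex with label 0 is linked: either by definition, or by a constant path in [x_j = 0], as the
   displacement has no zero in the cell. *)
case/orP: uj => [/eqP uj|/asboolP //]; apply: linked_face.
- exact/cell_cube/cell_stair.
- by rewrite mxE uj mul0r.
- exact/fj/cell_ball/cell_stair.
Unshelve. all: by end_near. Qed.
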